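(* Let $(X,T)$ be a dynamical system and let $\mu\in M(X)$. If $(T,\mu)$ satisfies LDT-III, then $(X,T)$ is an $E$-system. In particular, $T$ is $\mathscr{F}_{s}$-transitive.
   Context: A dynamical system is a pair $(X,T)$ where $X$ is a compact metric space and $T:X\to X$ is continuous. $M(X)$ is the set of Borel probability measures on $X$ (not assumed $T$-invariant) and $M(X,T)$ the set of $T$-invariant ones. $\mathrm{supp}(\mu)=\{x\in X:\mu(U)>0\text{ for any neighborhood }U\text{ of }x\}$. An observable is a continuous complex-valued function $\varphi\in C(X)$. $(T,\mu)$ satisfies LDT-III (the large deviations theorem of type III) if $\mathrm{supp}(\mu)=X$ and, for every observable $\varphi$ and any $\varepsilon>0$, $$\liminf_{n\to+\infty}\mu\left(\left\{x\in X:\left|\frac{1}{n}\sum_{i=0}^{n-1}\varphi\circ T^{i}(x)-\int_X\varphi\,\mathrm{d}\mu\right|>\varepsilon\right\}\right)=0.$$ With $\mathbb{Z}^+=\{0,1,2,\dots\}$, let $N(U,V)=\{n\in\mathbb{Z}^+:T^n(U)\cap V\ne\emptyset\}$. $(X,T)$ is topologically transitive if $N(U,V)\neq\emptyset$ for all nonempty open $U,V\subset X$. $(X,T)$ is an $E$-system if it is topologically transitive and there exists $\nu\in M(X,T)$ with $\mathrm{supp}(\nu)=X$. A set $S\subset\mathbb{Z}^+$ is syndetic if there is $N\in\mathbb{N}$ such that $\{i,i+1,\dots,i+N\}\cap S\neq\emptyset$ for every $i\in\mathbb{Z}^+$. $T$ is $\mathscr{F}_s$-transitive if $N(U,V)$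 is syndetic for all nonempty open $U,V\subset X$. *)

(* Defs.v *)
From HB Require Import structures.
From mathcomp Require Import all_boot all_order all_algebra.
From mathcomp Require Import all_classical all_reals all_analysis.
From mathcomp Require Import complex.
Import numFieldNormedType.Exports.

Set Implicit Arguments.
Unset Strict Implicit.
Unset Printing Implicit Defensive.

Local Open Scope classical_set_scope.
Local Open Scope ring_scope.
Local Open Scope complex_scope.

(* [measurableType] extends [pointedType], hence the base point. It costs no
   generality below: a space carrying a probability measure is nonempty. *)
#[short(type="pmetricType")]
HB.structure Definition PMetric (K : numDomainType) :=
  {M of Metric K M & Pointed M}.

Notation borelType X := (g_sigma_algebraType (@open X)).

Section measures.
Context {R : realType} {X : pmetricType R}.

(* Neighborhoods are taken open, hence measurable: a library measure has no
   meaningful value on a nonmeasurable neighborhood. *)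
Definition supp (mu : probability (borelType X) R) : set X :=
  [set x | forall U : set X, open U -> U x -> (0 < mu U)%E].

Definition invariant_measure (T : X -> X)
    (mu : probability (borelType X) R) : Prop :=
  forall A : set (borelType X), measurable A -> mu (T @^-1` A) = mu A.

(* [R[i]^o] is [R[i]] with the topology of the complex modulus. *)
Definition observable (phi : X -> R[i]) : Prop :=
  continuous (phi : X -> R[i]^o).

Definition complex_integral (mu : probability (borelType X) R)
    (phi : X -> R[i]) : R[i] :=
  (\int[mu]_x complex.Re (phi x)) +i* (\int[mu]_x complex.Im (phi x)).

Definition birkhoff_average (T : X -> X) (phi : X -> R[i]) (n : nat) (x : X)
    : R[i] :=
  n%:R^-1 * \sum_(0 <= i < n) phi (iter i T x).

(* The norm of [R[i]] takes its values in [R[i]], whose order restricted to the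
   real line is that of [R]. *)
Definition LDT_III (T : X -> X) (mu : probability (borelType X) R) : Prop :=
  supp mu = [set: X] /\
  forall phi : X -> R[i], observable phi ->
  forall eps : R, 0 < eps ->
    limn_einf (fun n => mu [set x |
      eps%:C < `|birkhoff_average T phi n x - complex_integral mu phi|]) = 0%E.

End measures.

Section dynamics.

Definition hitting_times {X : Type} (T : X -> X) (U V : set X) : set nat :=
  [set n | (iter n T @` U) `&` V !=set0].

Definition topologically_transitive {X : topologicalType} (T : X -> X) : Prop :=
  forall U V : set X, open U -> U !=set0 -> open V -> V !=set0 ->
    hitting_times T U V !=set0.

Definition syndetic (S : set nat) : Prop :=
  exists N : nat, forall i : nat,
    [set k | (i <= k <= i + N)%N] `&` S !=set0.

Definition Fs_transitive {X : topologicalType} (T : X -> X) : Prop :=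
  forall U V : set X, open U -> U !=set0 -> open V -> V !=set0 ->
    syndetic (hitting_times T U V).

Definition E_system {R : realType} {X : pmetricType R} (T : X -> X) : Prop :=
  topologically_transitive T /\
  exists nu : probability (borelType X) R,
    invariant_measure T nu /\ supp nu = [set: X].

End dynamics.

(* Main.v *)
Require Import Defs.
From HB Require Import structures.
From mathcomp Require Import all_boot all_order all_algebra.
From mathcomp Require Import all_classical all_reals all_analysis.
From mathcomp Require Import measurable_realfun complex lra.
Import numFieldNormedType.Exports.

Import Order.TTheory GRing.Theory Num.Theory.

Local Open Scope classical_set_scope.
Local Open Scope ring_scope.

(** The measure [mu] itself is the invariant measure of full support.  For [f]
    continuous, the single complex observable [f + i (f o T)] gives one large time
    at which, on a set of positive measure, the averages of [f] and of [f o T] are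
    both close to their integrals; as these averages differ by O(1/n), the
    integrals agree, and approximating indicators of open sets shows that [mu] is
    invariant.  Transitivity: with [f >= 0] continuous and positive exactly on [V],
    the points whose average of [f] is close to the positive integral of [f] have
    measure exceeding [1 - mu U] at some time, hence meet [U], and such a point
    enters [V].  Syndeticity: if [W] is a nonempty open subset of [U] that some
    [T^n] maps into [V], then [N(U, V)] contains [n + N(W, W)], and [N(W, W)] is
    syndetic by a packing form of Poincaré recurrence. *)

(** * Continuous functions positive exactly on an open set *)

Section depth.
Context {R : realType} {X : pmetricType R}.
Implicit Types U : set X.

(* The distance to the complement of [U], truncated at [1] so that it makes
   sense also when [U] is the whole space. *)
Definition depth U (x : X) : R := inf (1 |` [set mdist x y | y in ~` U]).

Lemma depth_has_lbound U x : has_lbound (1 |` [set mdist x y | y in ~` U]).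
Proof. by exists 0 => _ [->|[y _ <-]]; [exact: ler01|exact: mdist_ge0]. Qed.

Lemma depth_nonempty U x : 1 |` [set mdist x y | y in ~` U] !=set0.
Proof. by exists 1; left. Qed.

Lemma depth_ge0 U x : 0 <= depth U x.
Proof.
apply: lb_le_inf; first exact: depth_nonempty.
by move=> _ [->|[y _ <-]]; [exact: ler01|exact: mdist_ge0].
Qed.

Lemma depth_le1 U x : depth U x <= 1.
Proof. by apply: ge_inf; [exact: depth_has_lbound | left]. Qed.

Lemma depth_lipschitz U x y : depth U x <= mdist x y + depth U y.
Proof.
rewrite -lerBlDl; apply: lb_le_inf; first exact: depth_nonempty.
move=> _ [->|[z Uz <-]]; rewrite lerBlDl.
  by apply: le_trans (depth_le1 U x) _; rewrite lerDr mdist_ge0.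
apply: le_trans (metric_triangle x y z).
by apply: ge_inf; [exact: depth_has_lbound | right; exists z].
Qed.

Lemma continuous_depth U : continuous (depth U).
Proof.
move=> x; apply/cvgrPdist_lt => e e0; near=> y.
have xy : mdist x y < e.
  near: y; have := nbhsx_ballx x _ e0.
  by rewrite ballEmdist.
apply: le_lt_trans xy; rewrite ler_norml lerBlDr depth_lipschitz andbT.
by rewrite lerBrDl lerBlDl metric_sym depth_lipschitz.
Unshelve. all: by end_near. Qed.

Lemma depth_gt0P U x : open U -> reflect (U x) (0 < depth U x).
Proof.
move=> oU; apply: (iffP idP) => [|Ux].
  apply: contraPP => nUx; apply/negP; rewrite -leNgt.
  apply: ge_inf; first exact: depth_has_lbound.
  (* Outside [U], the value [mdist x x = 0] enters the infimum. *)
  by right; exists x => //; exact: mdistxx.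
have /nbhs_ballP[e /= e0 eU] : nbhs x U by exact: open_nbhs_nbhs.
have m0 : 0 < Num.min 1 e by rewrite lt_min ltr01.
apply: lt_le_trans m0 _; apply: lb_le_inf; first exact: depth_nonempty.
move=> _ [->|[y nUy <-]]; rewrite ge_min ?lexx//; apply/orP; right.
by rewrite leNgt; apply/negP => xy; apply: nUy; apply: eU; rewrite ballEmdist.
Qed.

End depth.

(** * Real Birkhoff averages and complex observables *)

Definition real_average {R : realType} {X : Type} (T : X -> X) (f : X -> R)
  (n : nat) (x : X) : R := n%:R^-1 * \sum_(0 <= i < n) f (iter i T x).

Section observables.
Local Open Scope complex_scope.
Context {R : realType}.

Lemma observable_complex {X : pmetricType R} (f g : X -> R) :
  continuous f -> continuous g -> observable (fun x => f x +i* g x).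
Proof.
move=> cf cg x; apply/cvgrPdist_lt => e; rewrite ltcE /= => /andP[/eqP e_im e0].
(* In the order of [R[i]], [0 < e] forces a zero imaginary part. *)
have -> : e = (complex.Re e)%:C by case: e e_im {e0} => a b /= ->.
have e20 : 0 < complex.Re e / 2 by rewrite divr_gt0.
near=> y.
have fy : `|f x - f y| < complex.Re e / 2.
  by near: y; move/cvgrPdist_lt : (cf x); exact.
have gy : `|g x - g y| < complex.Re e / 2.
  by near: y; move/cvgrPdist_lt : (cg x); exact.
rewrite normc_def ltcR /= [ltRHS]splitr; apply: le_lt_trans (ltrD fy gy).
rewrite -[leRHS]ger0_norm ?addr_ge0// -sqrtr_sqr ler_wsqrtr// [leRHS]sqrrD.
by rewrite !real_normK ?num_real// lerD2r lerDl mulrn_wge0// mulr_ge0.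
Unshelve. all: by end_near. Qed.

Lemma birkhoff_average_complex {X : pmetricType R} (T : X -> X) (f g : X -> R)
    n x :
  birkhoff_average T (fun x => f x +i* g x) n x
  = real_average T f n x +i* real_average T g n x.
Proof.
rewrite /birkhoff_average /real_average.
have -> : \sum_(0 <= i < n) (f (iter i T x) +i* g (iter i T x)) =
    (\sum_(0 <= i < n) f (iter i T x)) +i* (\sum_(0 <= i < n) g (iter i T x)).
  by elim/big_ind3 : _ => // a b c a' b' c' -> ->.
have -> : (n%:R^-1 : R[i]) = (n%:R^-1)%:C by rewrite fmorphV rmorph_nat.
by simpc.
Qed.

End observables.

(** The lower limit is the supremum of the tail infima, so each tail infimum is at most 0. *)
Lemma limn_einf_eq0 {R : realType} (u : (\bar R)^nat) (d : \bar R) (N : nat) :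
  limn_einf u = 0%E -> (0 < d)%E -> exists2 n, (N <= n)%N & (u n < d)%E.
Proof.
move=> u0 d0.
have /ereal_inf_lt[_ [n Nn <-] und] : (ereal_inf (sdrop u N) < d)%E.
  apply: le_lt_trans d0; rewrite -u0 limn_einf_lim.
  rewrite (cvg_lim _ (@cvg_einfs_sup _ u))//.
  by apply: ereal_sup_ubound; exists N.
by exists n.
Qed.

(** * Continuity and Borel measurability *)

Section continuity.
Context {R : realType} {X : pmetricType R}.

Lemma open_borel (U : set X) : open U -> measurable (U : set (borelType X)).
Proof. by move=> oU; exact: sub_sigma_algebra. Qed.

Lemma continuous_borel_measurable (f : X -> R) :
  continuous f -> measurable_fun setT (f : borelType X -> R).
Proof.
move=> /continuousP cf; apply: (measurability _ (RGenOpens.measurableE R)).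
move=> _ [_ [a [b ->] <-]]; rewrite setTI; apply: open_borel.
exact/cf/interval_open.
Qed.

Lemma continuous_borel_measurable_self (T : X -> X) :
  continuous T -> measurable_fun setT (T : borelType X -> borelType X).
Proof.
move=> /continuousP cT.
apply: (@measurability _ _ (borelType X) (borelType X) setT T (@open X)) => //.
by move=> _ [A oA <-]; rewrite setTI; apply: open_borel; exact: cT.
Qed.

Lemma continuous_iter (T : X -> X) (n : nat) :
  continuous T -> continuous (iter n T).
Proof.
move=> cT; elim: n => [|n IH] x; first exact: cvg_id.
by apply: continuous_comp; [exact: IH | exact: cT].
Qed.

Lemma continuous_real_average (T : X -> X) (f : X -> R) (n : nat) :
  continuous T -> continuous f -> continuous (real_average T f n).
Proof.
move=> cT cf x; rewrite /real_average; apply: cvgM; first exact: cvg_cst.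
have := @continuous_big R nat +%R 0 xpredT (@add_continuous R) X
  (index_iota 0 n) (fun i x => f (iter i T x)).
apply=> i _ y; apply: continuous_comp; last exact: cf.
exact: continuous_iter.
Qed.

End continuity.

(** * Simultaneous deviations of two real observables *)

Section LDT.
Context {R : realType} {X : pmetricType R}.
Variables (T : X -> X) (mu : probability (borelType X) R).
Hypotheses (contT : continuous T) (ldt : LDT_III T mu).

(* Packing two real functions into one complex observable provides a common
   time [n] at which both averages are close to the integrals. *)
Lemma LDT_III_pair (f g : X -> R) (eps : R) (d : \bar R) (N : nat) :
  continuous f -> continuous g -> 0 < eps -> (0 < d)%E ->
  exists n, exists A : set X, [/\ (N <= n)%N, open A, (mu A < d)%E &
    forall x, ~ A x -> `|real_average T f n x - \int[mu]_x f x| <= eps /\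
                       `|real_average T g n x - \int[mu]_x g x| <= eps].
Proof.
move=> cf cg eps0 d0.
have [_ /(_ _ (observable_complex _ _ cf cg) _ eps0) /limn_einf_eq0] := ldt.
move=> /(_ _ N d0)[n Nn And].
pose a := \int[mu]_x f x; pose b := \int[mu]_x g x.
pose h x := Num.sqrt ((real_average T f n x - a) ^+ 2 +
                      (real_average T g n x - b) ^+ 2).
have hE x : (`|birkhoff_average T (fun x => (f x +i* g x)%C) n x -
    complex_integral mu (fun x => (f x +i* g x)%C)| = (h x)%:C)%C.
  by rewrite birkhoff_average_complex normc_def.
exists n, [set x | eps < h x]; split => //.
- have ch : continuous h.
    have cdist (F : X -> R) c :
        continuous F -> continuous (fun x => (F x - c) ^+ 2).
      move=> cF y.
      apply: (@continuous_comp X R R (fun x => F x - c) (fun y => y ^+ 2)).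
        by apply: cvgB; [exact: cF|exact: cvg_cst].
      exact: exprn_continuous.
    move=> x; apply: continuous_comp; last exact: sqrt_continuous.
    by apply: cvgD; apply: cdist; exact: continuous_real_average.
  by move/continuousP : ch => /(_ [set y | eps < y]); apply; exact: open_gt.
- by move: And; under eq_set do rewrite hE ltcR.
- move=> x /= /negP; rewrite -leNgt => hx.
  (* The modulus [h x] dominates each of the two real deviations. *)
  split; apply: le_trans hx; rewrite -[leLHS]sqrtr_sqr ler_wsqrtr//.
    by rewrite lerDl sqr_ge0.
  by rewrite lerDr sqr_ge0.
Qed.
End LDT.

(** * Integrals of continuous functions and measures of open sets *)

Section integration.
Context {R : realType} {X : pmetricType R} (mu : probability (borelType X) R).

Lemma integrable_continuous01 (f : X -> R) : continuous f ->
  (forall x, 0 <= f x <= 1) -> mu.-integrable setT (EFin \o f).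
Proof.
move=> cf f01; apply: measurable_bounded_integrable => //.
- by rewrite ltey_eq fin_num_measure.
- exact: continuous_borel_measurable.
- exists 1; split; first exact: num_real.
  move=> M M1 x _ /=; have /andP[f0 f1] := f01 x.
  by rewrite ger0_norm// (le_trans f1)// ltW.
Qed.

Lemma integral_continuous01 (f : X -> R) : continuous f ->
  (forall x, 0 <= f x <= 1) ->
  (\int[mu]_x (f x)%:E = (\int[mu]_x f x)%R%:E)%E.
Proof.
move=> cf f01; rewrite fineK//; apply: integrable_fin_num => //.
exact: integrable_continuous01.
Qed.

Lemma continuous_flatten (f : X -> R) n :
  continuous f -> continuous (fun x => 1 - (1 - f x) ^+ n).
Proof.
move=> cf x; apply: cvgB; first exact: cvg_cst.
apply: (@continuous_comp X R R (fun x => 1 - f x) (fun y => y ^+ n)).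
  by apply: cvgB; [exact: cvg_cst|exact: cf].
exact: exprn_continuous.
Qed.

Lemma flatten01 (a : R) n : 0 <= a <= 1 -> 0 <= 1 - (1 - a) ^+ n <= 1.
Proof.
move=> /andP[a0 a1]; rewrite subr_ge0 lerBlDr lerDl exprn_ge0 ?subr_ge0//.
by rewrite exprn_ile1// ?subr_ge0// lerBlDr lerDl.
Qed.

(* [1 - (1 - f) ^+ n] increases to the indicator of [f > 0]. *)
Lemma cvg_measure_gt0 (f : X -> R) : continuous f ->
  (forall x, 0 <= f x <= 1) ->
  (\int[mu]_x (1 - (1 - f x) ^+ n)%:E)%E @[n --> \oo] --> mu [set x | 0 < f x].
Proof.
move=> cf f01; set A := [set x | 0 < f x].
have mA : measurable (A : set (borelType X)).
  apply: open_borel; move/continuousP : cf => /(_ [set y | 0 < y]); apply.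
  exact: open_gt.
have cg n : continuous (fun x => 1 - (1 - f x) ^+ n) by exact: continuous_flatten.
have g01 n x : 0 <= 1 - (1 - f x) ^+ n <= 1 by exact: flatten01.
rewrite -[A]setIT -integral_indic//.
(* The dominating function is the constant 1, integrable because [mu] is finite. *)
have [||||| _ _ cvgI] := @dominated_convergence _ (borelType X) R mu setT
  measurableT
  (fun n x => (1 - (1 - f x) ^+ n)%:E) (fun x => (\1_A x)%:E) (cst 1%E).
- move=> n; apply/measurable_EFinP; exact: continuous_borel_measurable.
- by apply/measurable_EFinP; exact: measurable_indic.
- apply: aeW => x _; apply: cvg_EFin; first exact: nearW.
  rewrite /= indicE; have /andP[f0 f1] := f01 x.
  case: (boolP (x \in A)) => [/set_mem /= fx|/negP nA].
    rewrite -[X in _ --> X]subr0; apply: cvgB; first exact: cvg_cst.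
    by apply: cvg_expr; rewrite ger0_norm ?subr_ge0// ltrBlDr ltrDl.
  have -> : f x = 0.
    apply/eqP; rewrite eq_le f0 andbT leNgt.
    by apply/negP => fx; apply: nA; rewrite inE.
  by under eq_fun do rewrite subr0 expr1n subrr; exact: cvg_cst.
- by apply: finite_measure_integrable_cst.
- apply: aeW => x n _; rewrite lee_fin ger0_norm; by case/andP: (g01 n x).
- exact: cvgI.
Qed.

(** A nonnegative function of zero integral vanishes almost everywhere, which would make [U]
    negligible. *)
Lemma Rintegral_depth_gt0 (U : set X) :
  open U -> (0 < mu U)%E -> 0 < \int[mu]_x depth U x.
Proof.
move=> oU U0; rewrite lt0r Rintegral_ge0 ?andbT; last first.
  by move=> *; exact: depth_ge0.
apply: contraTN U0 => /eqP int0; rewrite -leNgt.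
have d01 x : 0 <= depth U x <= 1 by rewrite depth_ge0 depth_le1.
have := integral_continuous01 _ (continuous_depth U) d01.
rewrite int0 => int0E.
have mD : measurable_fun setT (EFin \o depth U : borelType X -> \bar R).
  apply/measurable_EFinP; apply: continuous_borel_measurable.
  exact: continuous_depth.
have [|B [mB B0 UB]] := (ae_eq_integral_abs mu measurableT mD).1.
  rewrite -[RHS]int0E; apply: eq_integral => x _ /=.
  by rewrite ger0_norm ?depth_ge0.
rewrite -B0; apply: le_measure; rewrite ?inE//; first exact: open_borel.
move=> x Ux; apply: UB => /= /(_ I) [] /eqP.
by rewrite gt_eqF//; apply/depth_gt0P.
Qed.

(* By [cvg_measure_gt0] applied to the depth of an open set, integrals of
   continuous functions determine the measure of open sets. *)
Lemma invariant_measure_continuous01 (T : X -> X) : continuous T ->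
  (forall f : X -> R, continuous f -> (forall x, 0 <= f x <= 1) ->
     \int[mu]_x f (T x) = \int[mu]_x f x) ->
  invariant_measure T mu.
Proof.
move=> cT intT A mA.
have mT := continuous_borel_measurable_self _ cT.
pose TT : {mfun borelType X >-> borelType X} :=
  HB.pack (T : borelType X -> borelType X) (isMeasurableFun.Build _ _ _ _ _ mT).
(* Open sets are closed under intersection and generate the Borel sets, so it suffices that both
   measures agree on them. *)
apply: (@measure_unique _ R (borelType X) (@open X) (fun=> setT) erefl _ _ _
  (pushforward mu TT) mu _ _ A mA).
- by move=> U V; exact: openI.
- by move=> _; exact: openT.
- by rewrite bigcup_const//; exists 0%N.
- move=> U oU; rewrite /pushforward.
  have d01 x : 0 <= depth U x <= 1 by rewrite depth_ge0 depth_le1.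
  have cD := continuous_depth U.
  have cdT : continuous (depth U \o T).
    by move=> x; apply: continuous_comp; [exact: cT|exact: cD].
  pose V := [set x | 0 < depth U x].
  have -> : U = V by apply/seteqP; split => x /depth_gt0P; apply.
  have := cvg_measure_gt0 _ cD d01.
  have := cvg_measure_gt0 _ cdT (fun x => d01 (T x)).
  (* The hypothesis on [T], applied to the flattened depth, makes the two sequences of integrals
     equal; hence so are their limits. *)
  under eq_fun => n.
    rewrite (integral_continuous01 _ (continuous_flatten _ n cdT)); last first.
      by move=> x; exact/flatten01/d01.
    rewrite (intT _ (continuous_flatten _ n cD)); last first.
      by move=> x; exact/flatten01/d01.
    rewrite -integral_continuous01; last 2 first.
    - exact: continuous_flatten.
    - by move=> x; exact/flatten01/d01.
    over.
  exact: cvg_unique.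
- by move=> _; exact: le_lt_trans (probability_le1 mu measurableT) (ltry 1).
Qed.

End integration.

(** * Poincaré recurrence with bounded gaps *)

Section recurrence.
Context {R : realType} {X : pmetricType R}.
Variables (T : X -> X) (mu : probability (borelType X) R).
Hypotheses (contT : continuous T) (invT : invariant_measure T mu).

Lemma open_iter_preimage (n : nat) (W : set X) : open W -> open (iter n T @^-1` W).
Proof. by move=> oW; move/continuousP : (continuous_iter _ n contT); exact. Qed.

Lemma invariant_iter (n : nat) (W : set X) :
  open W -> mu (iter n T @^-1` W) = mu W.
Proof.
elim: n W => [//|n IH] W oW.
have oTW : open (T @^-1` W) by move/continuousP : contT; exact.
rewrite -[RHS](invT _ (open_borel _ oW)) -(IH _ oTW).
by congr (mu _).
Qed.

(* If return times missed arbitrarily long intervals, one could choose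
   arbitrarily many pairwise disjoint preimages of [W], all of the same measure. *)
Lemma return_times_syndetic (W : set X) :
  open W -> (0 < mu W)%E -> syndetic (hitting_times T W W).
Proof.
move=> oW W0; apply: contrapT => nsynd.
pose r : R := fine (mu W).
have muW : mu W = r%:E.
  by rewrite fineK// fin_num_measure//; exact: open_borel.
have r0 : 0 < r by rewrite -lte_fin -muW.
have gap M : exists i, forall k, (i <= k <= i + M)%N -> ~ hitting_times T W W k.
  apply: contrapT => ngap; apply: nsynd; exists M => i.
  apply: contrapT => /set0P/negP/negPn/eqP e; apply: ngap; exists i => k ik hk.
  by rewrite -[False]/(set0 k) -e.
(* [B] is a disjoint union of [m] preimages of [W], and [M] bounds the times involved. *)
have pack m : exists M, exists B : set X, [/\ open B,
    forall x, B x -> exists2 k, (k <= M)%N & W (iter k T x) &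
    mu B = (m%:R * r)%:E].
  elim: m => [|m [M [B [oB BM muB]]]].
    by exists 0%N, set0; split => //; [exact: open0|rewrite mul0r measure0].
  have [i gapi] := gap M.
  exists (i + M)%N, (B `|` iter (i + M) T @^-1` W).
  have oC := open_iter_preimage (i + M) _ oW.
  split; first exact: openU.
    move=> x [/BM[k kM Wk]|Wx]; last by exists (i + M)%N.
    by exists k => //; exact: leq_trans (leq_addl _ _).
  rewrite measureU; [|exact: open_borel|exact: open_borel|].
    by rewrite /= invariant_iter// muB muW -EFinD -natr1 mulrDl mul1r.
  apply/seteqP; split => // x [/BM[k kM Wk] /= Wx].
  (* A common point would give a return after [i + M - k] steps; as [k <= M], this time lies in the
     gap. *)
  apply: (gapi (i + M - k)%N).
    by rewrite leq_subr andbT -addnBA// leq_addr.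
  exists (iter (i + M) T x); split => //; exists (iter k T x) => //.
  by rewrite -iterD subnK// (leq_trans kM)// leq_addl.
(* More than [1 / r] disjoint preimages exceed the total mass 1. *)
pose m := Num.bound r^-1.
have rm : 1 < m%:R * r.
  by rewrite -ltr_pdivrMr// div1r; apply: archi_boundP; rewrite invr_ge0 ltW.
have [M [B [oB _ muB]]] := pack m.
have := probability_le1 mu (open_borel _ oB).
by rewrite muB lee_fin leNgt rm.
Qed.

End recurrence.

(** * Invariance, transitivity and syndeticity *)

Section conclusion.
Context {R : realType} {X : pmetricType R}.
Variables (T : X -> X) (mu : probability (borelType X) R).
Hypotheses (contT : continuous T) (ldt : LDT_III T mu).

Let full_support (U : set X) : open U -> U !=set0 -> (0 < mu U)%E.
Proof.
move=> oU [x Ux]; have [suppmu _] := ldt.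
have : supp mu x by rewrite suppmu.
exact.
Qed.

Lemma LDT_III_integral (f : X -> R) : continuous f ->
  (forall x, 0 <= f x <= 1) -> \int[mu]_x f (T x) = \int[mu]_x f x.
Proof.
move=> cf f01; apply/eqP; rewrite -subr_eq0 -normr_le0.
apply/ler_addgt0Pl => e e0; rewrite addr0.
(* One third for each of the two integrals, one for the shift by [T]. *)
have e30 : 0 < e / 3 by rewrite divr_gt0.
have cfT : continuous (f \o T).
  by move=> x; apply: continuous_comp; [exact: contT|exact: cf].
pose N := (Num.bound (e / 3)^-1).
(* The bound [N.+1] gives [0 < n] and [1 / n <= e / 3]; measure below 1 leaves a point outside
   [A]. *)
have [n [A [Nn oA A1 near_int]]] :=
  LDT_III_pair _ _ contT ldt _ _ _ _ N.+1 cf cfT e30 lte01.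
have [x nAx] : exists x, ~ A x.
  apply: contrapT => /forallNP AT; move: A1.
  have -> : A = setT by apply/seteqP; split => // x _; exact: contrapT.
  by rewrite probability_setT ltxx.
have [] := near_int x nAx.
have n0 : 0 < n%:R :> R by rewrite ltr0n (leq_trans _ Nn).
(* The sum telescopes to [f (iter n T x) - f x], of absolute value at most 1. *)
have shift : `|real_average T f n x - real_average T (f \o T) n x| <= e / 3.
  rewrite -normrN opprB /real_average -mulrBr -sumrB.
  rewrite (telescope_sumr (fun i => f (iter i T x)))// normrM.
  have n1 : n%:R^-1 <= e / 3.
    rewrite -[leRHS]invrK lef_pV2 ?posrE ?invr_gt0//.
    apply: ltW.
    apply: lt_le_trans (archi_boundP _) _; first by rewrite invr_ge0 ltW.
    by rewrite ler_nat ltnW.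
  rewrite ger0_norm ?invr_ge0//; apply: le_trans n1.
  rewrite -[leRHS]mulr1 ler_wpM2l ?invr_ge0//.
  have /andP[? ?] := f01 (iter n T x); have /andP[? ?] := f01 (iter 0 T x).
  by rewrite ler_norml; apply/andP; split; lra.
move: shift; rewrite !ler_norml => /andP[? ?] /andP[? ?] /andP[? ?].
by apply/andP; split; lra.
Qed.

Lemma LDT_III_invariant : invariant_measure T mu.
Proof. exact: invariant_measure_continuous01 LDT_III_integral. Qed.

Lemma LDT_III_transitive : topologically_transitive T.
Proof.
move=> U V oU U0 oV V0.
have int0 := Rintegral_depth_gt0 mu _ oV (full_support _ oV V0).
have int2 : 0 < (\int[mu]_x depth V x) / 2 by rewrite divr_gt0.
have cD := @continuous_depth _ _ V.
(* Taking [mu U] as the threshold prevents [A] from covering [U]; an error of half the integral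
   keeps the average positive. *)
have [n [A [_ oA AU near_int]]] :=
  LDT_III_pair _ _ contT ldt _ _ _ _ 0 cD cD int2
    (full_support _ oU U0).
have [x [Ux nAx]] : exists x, U x /\ ~ A x.
  apply: contrapT => nUA; move: AU; rewrite ltNge => /negP; apply.
  apply: le_measure; rewrite ?inE; [exact: open_borel|exact: open_borel|].
  by move=> x Ux; apply: contrapT => nAx; apply: nUA; exists x.
have [+ _] := near_int x nAx; rewrite ler_norml => /andP[avg_ge _].
have avg0 : 0 < real_average T (depth V) n x by lra.
have [i _ /depth_gt0P Vi] : exists2 i, (i < n)%N & 0 < depth V (iter i T x).
  apply: contrapT => nV; move: avg0; rewrite ltNge => /negP; apply.
  rewrite /real_average mulr_ge0_le0 ?invr_ge0// big_mkord sumr_le0// => i _.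
  by rewrite leNgt; apply/negP => di; apply: nV; exists i.
by exists i, (iter i T x); split; [exists x|exact: Vi].
Qed.

Lemma LDT_III_Fs_transitive : Fs_transitive T.
Proof.
move=> U V oU U0 oV V0.
have [n [_ [[x Ux <-] Vx]]] := LDT_III_transitive _ _ oU U0 oV V0.
pose W := U `&` iter n T @^-1` V.
have oW : open W by apply: openI => //; exact: open_iter_preimage.
have [N hitN] := return_times_syndetic _ _ contT LDT_III_invariant _ oW
  (full_support _ oW (ex_intro _ x (conj Ux Vx))).
(* A return to [W] at time [k] yields a hit of [V] at time [n + k], so the window grows by [n]. *)
exists (n + N)%N => i.
have [k [/andP[ik kN] [_ [[y [Uy _] <-] [_ Vy]]]]] := hitN i.
exists (n + k)%N; split => /=.
  by rewrite (leq_trans ik) ?leq_addl//= addnCA leq_add2l.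
by exists (iter n T (iter k T y)); split => //; exists y => //; rewrite iterD.
Qed.

End conclusion.

Theorem theorem5p2 (R : realType) (X : pmetricType R) (T : X -> X)
    (compactX : compact [set: X]) (contT : continuous T)
    (mu : probability (borelType X) R) :
  LDT_III T mu -> E_system T /\ Fs_transitive T.
Proof.
move=> ldt; split; last exact: LDT_III_Fs_transitive ldt.
split; first exact: LDT_III_transitive ldt.
exists mu; split; first exact: LDT_III_invariant ldt.
by case: ldt.
Qed.
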